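(* Let $G$ be a graph with degree sequence $\{d_1,\dots,d_n\}$, with smallest degree $\delta$ and largest degree $\Delta$. For $0\le\alpha<1$, the $A_\alpha$-spectral radius $p_1$ of $G$ satisfies $\delta\le p_1\le\Delta$. If $G$ is connected, then equality in either case (i.e. $p_1=\delta$, or $p_1=\Delta$) holds if and only if $G$ is regular.
   Context: Graphs are finite and simple. For a graph $G$ with adjacency matrix $A(G)$ and diagonal degree matrix $D(G)$, and $0\le\alpha\le1$, $A_\alpha(G)=\alpha D(G)+(1-\alpha)A(G)$. The $A_\alpha$-spectral radius $p_1$ is the largest eigenvalue of $A_\alpha(G)$. *)

(* Defs.v *)
From mathcomp Require Import all_boot all_order all_algebra.
From mathcomp Require Import boolp classical_sets reals.

Set Implicit Arguments.
Unset Strict Implicit.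
Unset Printing Implicit Defensive.

Import Order.TTheory GRing.Theory Num.Theory.
Local Open Scope classical_set_scope.
Local Open Scope ring_scope.

Record sgraph (n : nat) := SGraph {
  edge :> rel 'I_n;
  edge_sym : symmetric edge;
  edge_irrefl : irreflexive edge
}.

Definition degree n (G : sgraph n) (i : 'I_n) : nat := #|G i|.

Definition max_degree n (G : sgraph n) : nat := (\max_(i < n) degree G i)%N.

(* Every degree is < n, so the neutral value n is never attained when n > 0. *)
Definition min_degree n (G : sgraph n) : nat := \big[minn/n]_(i < n) degree G i.

Definition regular_graph n (G : sgraph n) : Prop :=
  exists k : nat, forall i, degree G i = k.

Definition connected_graph n (G : sgraph n) : Prop :=
  forall i j, connect G i j.

Definition adjacency_mx (R : realType) n (G : sgraph n) : 'M[R]_n :=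
  \matrix_(i, j) (G i j)%:R.

Definition degree_mx (R : realType) n (G : sgraph n) : 'M[R]_n :=
  diag_mx (\row_i (degree G i)%:R).

Definition Aalpha_mx (R : realType) n (alpha : R) (G : sgraph n) : 'M[R]_n :=
  alpha *: degree_mx R G + (1 - alpha) *: adjacency_mx R G.

(* Unique when it exists, which is the case for every nonempty symmetric real
   matrix; [eigenvalue] only sees the eigenvalues lying in R.  The value 0 is
   used only for matrices without any real eigenvalue. *)
Definition largest_eigenvalue (R : realType) n (M : 'M[R]_n) : R :=
  xget 0 [set p : R | eigenvalue M p /\
                      forall q, eigenvalue M q -> q <= p].

Definition Aalpha_radius (R : realType) n (alpha : R) (G : sgraph n) : R :=
  largest_eigenvalue (Aalpha_mx alpha G).

(* Main.v *)
(** For symmetric [M], the supremum [m] of the Rayleigh quotient is an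
    eigenvalue: [N = m I - M] is positive semidefinite, and if it were
    invertible, Cauchy-Schwarz for the form of [N], applied to [x] and
    [x N^-1], would give [|x|^4 <= (x N x^T) (x N^-1 x^T)], so [x N x^T] would
    be at least a positive multiple of [|x|^2], against the choice of [m].
    Hence the largest eigenvalue [p] dominates the Rayleigh quotient.  The
    constant vector shows that [p] is at least the average degree.  The upper
    bound and its equality case come from
    [x A_alpha x^T =
       sum_i d_i x_i^2 - (1 - alpha) / 2 * sum_(i ~ j) (x_i - x_j)^2],
    where the last sum ranges over ordered pairs. *)
Require Import Defs.
From mathcomp Require Import all_boot all_order all_algebra.
From mathcomp Require Import boolp classical_sets reals.
From mathcomp Require Import ring lra.

Set Implicit Arguments.
Unset Strict Implicit.
Unset Printing Implicit Defensive.

Import Order.TTheory GRing.Theory Num.Theory.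
Local Open Scope ring_scope.

(** * Quadratic forms of symmetric real matrices and the Rayleigh quotient *)

Definition bilinear_form (R : realType) n (M : 'M[R]_n) (x y : 'rV[R]_n) : R :=
  (x *m M *m y^T) 0 0.

Definition sqnorm (R : realType) n (x : 'rV[R]_n) : R := \sum_i x 0 i ^+ 2.

Section RayleighQuotient.
Variables (R : realType) (n : nat).
Implicit Types (M N : 'M[R]_n) (x y : 'rV[R]_n).

Lemma bilinear_formE M x y :
  bilinear_form M x y = \sum_i \sum_j M i j * (x 0 i * y 0 j).
Proof.
rewrite /bilinear_form !mxE exchange_big; apply: eq_bigr => j _ /=.
rewrite !mxE mulr_suml; apply: eq_bigr => i _; ring.
Qed.

Lemma sqnormE x : sqnorm x = (x *m x^T) 0 0.
Proof. by rewrite !mxE; apply: eq_bigr => i _; rewrite !mxE expr2. Qed.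

Lemma sqnorm_ge0 x : 0 <= sqnorm x.
Proof. by apply: sumr_ge0 => i _; apply: sqr_ge0. Qed.

Lemma sqnorm_gt0 x : x != 0 -> 0 < sqnorm x.
Proof.
move=> x0; rewrite lt_neqAle sqnorm_ge0 andbT eq_sym.
apply: contra x0 => /eqP s0; apply/eqP/rowP => i; rewrite mxE.
apply/eqP; rewrite -sqrf_eq0; apply/eqP.
exact: (psumr_eq0P (fun j _ => sqr_ge0 (x 0 j)) s0).
Qed.

Lemma bilinear_form_eigen M x p :
  x *m M = p *: x -> bilinear_form M x x = p * sqnorm x.
Proof. by move=> e; rewrite /bilinear_form e -scalemxAl mxE sqnormE. Qed.

Lemma bilinear_form_scalar_sub M m x :
  bilinear_form (m%:M - M) x x = m * sqnorm x - bilinear_form M x x.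
Proof.
rewrite /bilinear_form mulmxBr mulmxBl mul_mx_scalar -scalemxAl.
by rewrite [LHS]mxE [X in X + _]mxE [X in _ + X]mxE sqnormE.
Qed.

Lemma bilinear_formC M x y :
  M^T = M -> bilinear_form M y x = bilinear_form M x y.
Proof.
move=> symM; rewrite !bilinear_formE exchange_big.
apply: eq_bigr => i _; apply: eq_bigr => j _ /=.
by rewrite -{1}symM mxE [y _ _ * _]mulrC.
Qed.

Lemma bilinear_form_bounded M :
  exists2 C : R, 0 < C & forall x, bilinear_form M x x <= C * sqnorm x.
Proof.
(* The summand 1 keeps the constant positive even for [M = 0], so that it can be inverted later. *)
exists (1 + \sum_i \sum_j `|M i j|).
  by rewrite ltr_pwDl// sumr_ge0// => i _; rewrite sumr_ge0.
move=> x; rewrite bilinear_formE.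
have le_sq i : x 0 i ^+ 2 <= sqnorm x.
  by rewrite /sqnorm (bigD1 i)//= lerDl sumr_ge0// => j _; apply: sqr_ge0.
rewrite mulrDl mul1r mulr_suml; apply: ler_wpDl; first exact: sqnorm_ge0.
apply: ler_sum => i _; rewrite mulr_suml; apply: ler_sum => j _.
apply: (le_trans (ler_norm _)); rewrite normrM ler_wpM2l//.
have := le_sq i; have := le_sq j.
have := sqr_ge0 (x 0 i - x 0 j); have := sqr_ge0 (x 0 i + x 0 j).
rewrite sqrrB sqrrD => h1 h2 h3 h4; rewrite ler_norml; apply/andP; split; lra.
Qed.

(** The form at [x + t *: y] is a quadratic polynomial in [t] that is nowhere negative. The form may
    be degenerate, so the leading coefficient [c] can be zero for a nonzero [y]. *)
Lemma psd_CauchySchwarz N x y :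
  N^T = N -> (forall z, 0 <= bilinear_form N z z) ->
  bilinear_form N x y ^+ 2 <= bilinear_form N x x * bilinear_form N y y.
Proof.
move=> symN psd; set a := bilinear_form N x x; set c := bilinear_form N y y.
set b := bilinear_form N x y.
have byx : bilinear_form N y x = b by exact: bilinear_formC.
have quad t : 0 <= a + 2 * t * b + t ^+ 2 * c.
  have := psd (x + t *: y).
  suff -> : bilinear_form N (x + t *: y) (x + t *: y) =
      a + t * bilinear_form N y x + t * b + t ^+ 2 * c.
    by rewrite byx; congr (_ <= _); ring.
  rewrite /a /b /c !bilinear_formE !mulr_sumr -!big_split.
  apply: eq_bigr => i _ /=; rewrite !mulr_sumr -!big_split.
  by apply: eq_bigr => j _ /=; rewrite !mxE; ring.
have [c0|c0] := eqVneq c 0.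
  suff -> : b = 0 by rewrite expr0n c0 mulr0.
  (* With [c = 0] the polynomial is affine in [t]; for [b != 0] this [t] gives it the value -1. *)
  apply/eqP/negPn/negP => b0; have := quad (- (a + 1) / (2 * b)).
  rewrite c0; have -> : a + 2 * (- (a + 1) / (2 * b)) * b +
    (- (a + 1) / (2 * b)) ^+ 2 * 0 = -1 by field.
  by lra.
have cp : 0 < c by rewrite lt_neqAle eq_sym c0 psd.
(* The polynomial attains its minimum at [- b / c]. *)
have := quad (- b / c); rewrite -(pmulr_lge0 _ cp).
have -> : (a + 2 * (- b / c) * b + (- b / c) ^+ 2 * c) * c = a * c - b ^+ 2.
  by field.
by rewrite subr_ge0.
Qed.

Lemma psd_unit_coercive N :
  N^T = N -> (forall z, 0 <= bilinear_form N z z) -> N \in unitmx ->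
  exists2 c : R, 0 < c & forall x, c * sqnorm x <= bilinear_form N x x.
Proof.
move=> symN psd unitN; have [C C0 HC] := bilinear_form_bounded (invmx N).
(* [C] bounds the form of [invmx N], so Cauchy-Schwarz yields [|x|^4 <= (x N x^T) * C |x|^2];
   dividing by [C |x|^2] leaves the constant [C^-1]. *)
exists C^-1; first by rewrite invr_gt0.
move=> x; have [->|x0] := eqVneq x 0.
  by rewrite /sqnorm big1 ?mulr0// => i _; rewrite mxE expr0n.
have s0 := sqnorm_gt0 x0.
have symV : (invmx N)^T = invmx N by rewrite trmx_inv symN.
have := psd_CauchySchwarz x (x *m invmx N) symN psd.
have -> : bilinear_form N x (x *m invmx N) = sqnorm x.
  by rewrite sqnormE /bilinear_form trmx_mul symV mulmxA mulmxK.
have -> : bilinear_form N (x *m invmx N) (x *m invmx N)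
    = bilinear_form (invmx N) x x.
  by rewrite /bilinear_form trmx_mul symV mulmxKV// mulmxA.
move=> /le_trans/(_ (ler_wpM2l (psd x) (HC x))).
by rewrite expr2 mulrA ler_pM2r// ler_pdivrMl// mulrC.
Qed.

Lemma eigenvalue_rayleigh_max M : (0 < n)%N -> M^T = M ->
  exists2 p : R, eigenvalue M p &
    forall x, bilinear_form M x x <= p * sqnorm x.
Proof.
move=> n0 symM.
pose S : set R := [set r | exists2 x : 'rV[R]_n, x != 0 &
  r = bilinear_form M x x / sqnorm x]%classic.
have S0 : (S !=set0)%classic.
  pose u : 'rV[R]_n := const_mx 1.
  exists (bilinear_form M u u / sqnorm u); exists u => //; apply/eqP => /rowP/(_ (Ordinal n0)).
  by rewrite !mxE => /eqP; rewrite oner_eq0.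
have SB : has_sup S.
  split=> //; have [C _ HC] := bilinear_form_bounded M; exists C => _ [x x0 ->].
  by rewrite ler_pdivrMr ?sqnorm_gt0.
have dom x : bilinear_form M x x <= sup S * sqnorm x.
  have [->|x0] := eqVneq x 0.
    by rewrite /bilinear_form !mul0mx mxE /sqnorm big1 ?mulr0// => i _;
       rewrite mxE expr0n.
  by rewrite -ler_pdivrMr ?sqnorm_gt0//; apply: ub_le_sup; [case: SB|exists x].
exists (sup S) => //.
(* If [sup S] is not an eigenvalue, then [M - (sup S)%:M] is invertible, and so is its opposite
   [N]. *)
rewrite /eigenvalue /eigenspace kermx_eq0 row_free_unit; apply/negP => uM.
pose N := (sup S)%:M - M.
have symN : N^T = N by rewrite /N linearB /= tr_scalar_mx symM.
have psd z : 0 <= bilinear_form N z z.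
  by rewrite bilinear_form_scalar_sub subr_ge0.
have unitN : N \in unitmx by rewrite /N -opprB -scaleN1r unitmxZ ?unitrN1.
have [c c0 Hc] := psd_unit_coercive symN psd unitN.
(* Coercivity of [N] makes [sup S - c] an upper bound of the Rayleigh quotients. *)
suff : sup S <= sup S - c by lra.
apply: ge_sup => // _ [x x0 ->].
rewrite ler_pdivrMr ?sqnorm_gt0//; have := Hc x.
rewrite bilinear_form_scalar_sub; lra.
Qed.

(** An eigenvalue is the Rayleigh quotient of its eigenvector, so an eigenvalue that dominates the
    quotient is the largest one. Its existence also rules out the default value of [xget]. *)
Lemma largest_eigenvalueP M : (0 < n)%N -> M^T = M ->
  eigenvalue M (largest_eigenvalue M) /\
  forall x, bilinear_form M x x <= largest_eigenvalue M * sqnorm x.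
Proof.
move=> n0 symM; have [p ep Hp] := eigenvalue_rayleigh_max n0 symM.
have pmax q : eigenvalue M q -> q <= p.
  move=> /eigenvalueP[x /bilinear_form_eigen e x0].
  by have := Hp x; rewrite e ler_pM2r ?sqnorm_gt0.
have [eL HL] : eigenvalue M (largest_eigenvalue M) /\
    forall q, eigenvalue M q -> q <= largest_eigenvalue M.
  rewrite /largest_eigenvalue; case: xgetP => [? _ //|/(_ p) []].
  by split.
have -> : largest_eigenvalue M = p by apply/le_anti; rewrite pmax// HL.
by [].
Qed.

End RayleighQuotient.

(** * The quadratic form of [Aalpha_mx], and extreme degrees *)

Section AalphaForm.
Variables (R : realType) (n : nat) (G : sgraph n) (alpha : R).
Implicit Types x : 'rV[R]_n.

Lemma Aalpha_mx_sym : (Aalpha_mx alpha G)^T = Aalpha_mx alpha G.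
Proof.
apply/matrixP => i j; rewrite !mxE (edge_sym G i j) eq_sym.
by case: eqP => // ->.
Qed.

Lemma natr_degree i : (degree G i)%:R = \sum_j (G i j)%:R :> R.
Proof.
rewrite /degree -sum1_card natr_sum big_mkcond.
apply: eq_bigr => j _ /=; rewrite -[j \in _]/(G i j).
by case: (G i j).
Qed.

Lemma degree_form x :
  \sum_i (degree G i)%:R * x 0 i ^+ 2 =
  \sum_i \sum_j (G i j)%:R * x 0 i ^+ 2.
Proof. by apply: eq_bigr => i _; rewrite natr_degree mulr_suml. Qed.

Lemma Aalpha_formE x :
  bilinear_form (Aalpha_mx alpha G) x x =
  \sum_i (degree G i)%:R * x 0 i ^+ 2 -
  (1 - alpha) / 2 * \sum_i \sum_j (G i j)%:R * (x 0 i - x 0 j) ^+ 2.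
Proof.
set D := \sum_i (degree G i)%:R * _.
set A := \sum_i \sum_j (G i j)%:R * (x 0 i * x 0 j).
have -> : bilinear_form (Aalpha_mx alpha G) x x = alpha * D + (1 - alpha) * A.
  rewrite bilinear_formE /D /A !mulr_sumr -big_split; apply: eq_bigr => i _ /=.
  (* The degree matrix contributes only to the term [j = i], which is split off on both sides. *)
  rewrite mulr_sumr (bigD1 i)//= [in RHS](bigD1 i)//= addrA; congr (_ + _).
    by rewrite !mxE eqxx mulr1n; ring.
  apply: eq_bigr => j ji; rewrite !mxE eq_sym (negbTE ji) mulr0n; ring.
suff -> : \sum_i \sum_j (G i j)%:R * (x 0 i - x 0 j) ^+ 2 = 2 * D - 2 * A.
  by field.
(* By symmetry of the edge relation, each of the two squares in the expansion of [(x_i - x_j)^2]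
   sums to [D]. *)
have D' : D = \sum_i \sum_j (G i j)%:R * x 0 j ^+ 2.
  rewrite /D degree_form exchange_big.
  apply: eq_bigr => i _; apply: eq_bigr => j _ /=.
  by rewrite edge_sym.
transitivity (D + D - 2 * A); last by ring.
rewrite {1}D' /D degree_form /A mulr_sumr -sumrN -!big_split.
apply: eq_bigr => i _ /=.
rewrite mulr_sumr -sumrN -!big_split; apply: eq_bigr => j _ /=; ring.
Qed.

Lemma degree_le_max i : (degree G i <= max_degree G)%N.
Proof. exact: leq_bigmax. Qed.

Lemma min_le_degree i : (min_degree G <= degree G i)%N.
Proof.
rewrite /min_degree; have := mem_index_enum i.
elim: (index_enum _) => // j s IH; rewrite inE big_cons geq_min.
by case/predU1P => [->|/IH ->]; rewrite ?leqnn ?orbT.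
Qed.

Lemma regular_min_max_degree : (0 < n)%N -> regular_graph G ->
  min_degree G = max_degree G.
Proof.
move=> n0 [k Hk]; have Hmax : max_degree G = k.
  apply/eqP; rewrite eqn_leq -{2}(Hk (Ordinal n0)) degree_le_max andbT.
  by apply/bigmax_leqP => i _; rewrite Hk.
rewrite Hmax; apply/eqP; rewrite eqn_leq -{1}(Hk (Ordinal n0)) min_le_degree /=.
rewrite /min_degree; elim/big_ind: _ => [|a b ha hb|i _]; last by rewrite Hk.
  (* The neutral value [n] of the minimum does no harm: [k] is a degree, hence at most [n]. *)
  by rewrite -(Hk (Ordinal n0)) /degree (leq_trans (max_card _)) ?card_ord.
by rewrite leq_min ha.
Qed.

(** * Degree bounds on the spectral radius and their equality cases *)

Hypotheses (n_gt0 : (0 < n)%N) (alpha_lt1 : alpha < 1).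
Let p1 := Aalpha_radius alpha G.

(** On the all-ones vector the edge differences vanish, so its form is the degree sum, while its
    squared norm is [n]. *)
Lemma sum_degree_le_Aalpha_radius : \sum_i (degree G i)%:R <= p1 * n%:R.
Proof.
have [_ /(_ (const_mx 1))] := largest_eigenvalueP n_gt0 Aalpha_mx_sym.
rewrite Aalpha_formE [X in _ * X]big1 ?mulr0 ?subr0; last first.
  by move=> i _; rewrite big1// => j _; rewrite !mxE subrr expr0n mulr0.
rewrite /sqnorm; under eq_bigr do rewrite mxE expr1n mulr1.
by under [X in _ * X]eq_bigr do rewrite mxE expr1n; rewrite sumr_const card_ord.
Qed.

Lemma Aalpha_radius_ge_min : (min_degree G)%:R <= p1.
Proof.
rewrite -(ler_pM2r (x := n%:R)) ?ltr0n//.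
apply: le_trans sum_degree_le_Aalpha_radius.
rewrite mulr_natr -[X in _ *+ X]card_ord -sumr_const.
by apply: ler_sum => i _; rewrite ler_nat min_le_degree.
Qed.

(** The nonnegative numbers [d_i - min_degree G] then have a sum that is at most 0, so each of them
    vanishes. *)
Lemma Aalpha_radius_eq_min : p1 = (min_degree G)%:R -> regular_graph G.
Proof.
move=> e; have := sum_degree_le_Aalpha_radius.
rewrite e mulr_natr -[X in _ *+ X]card_ord -sumr_const -subr_le0 -sumrB => le0.
have ge0 i : true -> 0 <= (degree G i)%:R - (min_degree G)%:R :> R.
  by rewrite subr_ge0 ler_nat min_le_degree.
exists (min_degree G) => i; apply/eqP; rewrite -(eqr_nat R) -subr_eq0; apply/eqP.
by apply: (psumr_eq0P ge0) => //; apply/le_anti; rewrite le0 sumr_ge0.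
Qed.

(** For [alpha < 1] both subtracted sums are nonnegative: this gives the upper bound, and equality
    forces both to vanish at an eigenvector. *)
Lemma Aalpha_form_slack x : bilinear_form (Aalpha_mx alpha G) x x =
  (max_degree G)%:R * sqnorm x -
  (\sum_i ((max_degree G)%:R - (degree G i)%:R) * x 0 i ^+ 2 +
   (1 - alpha) / 2 * \sum_i \sum_j (G i j)%:R * (x 0 i - x 0 j) ^+ 2).
Proof.
rewrite Aalpha_formE opprD addrA; congr (_ - _).
by rewrite /sqnorm mulr_sumr -sumrB; apply: eq_bigr => i _; ring.
Qed.

Let degree_slack_ge0 x i : true ->
  0 <= ((max_degree G)%:R - (degree G i)%:R) * x 0 i ^+ 2.
Proof. by rewrite mulr_ge0 ?sqr_ge0// subr_ge0 ler_nat degree_le_max. Qed.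

Let edge_slack_ge0 x i j : true -> 0 <= (G i j)%:R * (x 0 i - x 0 j) ^+ 2.
Proof. by rewrite mulr_ge0 ?sqr_ge0. Qed.

Let edge_slack_row_ge0 x i : true ->
  0 <= \sum_j (G i j)%:R * (x 0 i - x 0 j) ^+ 2.
Proof. by move=> _; exact: sumr_ge0 (@edge_slack_ge0 x i). Qed.

Lemma Aalpha_radius_le_max : p1 <= (max_degree G)%:R.
Proof.
have [/eigenvalueP[x /bilinear_form_eigen e x0] _] :=
  largest_eigenvalueP n_gt0 Aalpha_mx_sym.
rewrite -(ler_pM2r (sqnorm_gt0 x0)) -e Aalpha_form_slack gerBl addr_ge0//.
  exact: sumr_ge0 (@degree_slack_ge0 x).
rewrite mulr_ge0 ?(sumr_ge0 _ (@edge_slack_row_ge0 x))//.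
by rewrite divr_ge0// subr_ge0 ltW.
Qed.

(** At an eigenvector the edge sum vanishes, so [x] is constant along edges and, by connectedness,
    everywhere. Being nonzero, [x] has no zero entry, and the vanishing degree sum then makes every
    degree maximal. *)
Lemma Aalpha_radius_eq_max : connected_graph G ->
  p1 = (max_degree G)%:R -> regular_graph G.
Proof.
move=> conn p1E; have [/eigenvalueP[x /bilinear_form_eigen e x0] _] :=
  largest_eigenvalueP n_gt0 Aalpha_mx_sym.
move: e; rewrite Aalpha_form_slack -/(Aalpha_radius alpha G) -/p1 p1E.
set S2 := \sum_i _; set S1 := \sum_i _ => e.
have S1_ge0 : 0 <= S1 := sumr_ge0 _ (@degree_slack_ge0 x).
have S2_ge0 : 0 <= S2 := sumr_ge0 _ (@edge_slack_row_ge0 x).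
have c_gt0 : 0 < (1 - alpha) / 2 by rewrite divr_gt0// subr_gt0.
have cS2_ge0 := mulr_ge0 (ltW c_gt0) S2_ge0.
have S1_0 : S1 = 0 by lra.
have /eqP : (1 - alpha) / 2 * S2 = 0 by lra.
rewrite mulf_eq0 gt_eqF//= => /eqP S2_0.
have x_edge i j : G i j -> x 0 i = x 0 j.
  move=> Gij; have /eqP := psumr_eq0P (@edge_slack_ge0 x i)
    (psumr_eq0P (@edge_slack_row_ge0 x) S2_0 isT) (isT : xpredT j).
  by rewrite Gij mul1r sqrf_eq0 subr_eq0 => /eqP.
have x_const i j : x 0 i = x 0 j.
  have /connectP[s sp ->] := conn i j.
  elim: s i sp => //= k s IH i /andP[Gik /IH <-]; exact: x_edge.
have x_neq0 i : x 0 i != 0.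
  apply: contra x0 => /eqP xi0; apply/eqP/rowP => j.
  by rewrite (x_const j i) xi0 mxE.
exists (max_degree G) => i.
have /eqP := psumr_eq0P (@degree_slack_ge0 x) S1_0 (isT : xpredT i).
rewrite mulf_eq0 sqrf_eq0 (negbTE (x_neq0 i)) orbF subr_eq0 eqr_nat.
by move=> /eqP.
Qed.

End AalphaForm.

Theorem theorem3p2 (R : realType) (n : nat) (G : sgraph n) (alpha : R)
    (n_gt0 : (0 < n)%N) (alpha_ge0 : 0 <= alpha) (alpha_lt1 : alpha < 1) :
  let p1 := Aalpha_radius alpha G in
  ((min_degree G)%:R <= p1 <= (max_degree G)%:R) /\
  (connected_graph G ->
     (p1 = (min_degree G)%:R <-> regular_graph G) /\
     (p1 = (max_degree G)%:R <-> regular_graph G)).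
Proof.
move=> p1.
have bounds : (min_degree G)%:R <= p1 <= (max_degree G)%:R.
  by rewrite Aalpha_radius_ge_min//= Aalpha_radius_le_max.
split=> // conn.
(* For a regular graph the two bounds coincide and pin [p1]; this settles the converse of both
   equivalences. *)
have reg_max : regular_graph G -> p1 = (max_degree G)%:R.
  move=> reg; move: bounds; rewrite (regular_min_max_degree n_gt0 reg).
  by move=> /le_anti.
split; split=> [|reg].
- exact: Aalpha_radius_eq_min.
- by rewrite (regular_min_max_degree n_gt0 reg) reg_max.
- exact: Aalpha_radius_eq_max.
- exact: reg_max.
Qed.
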